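(* Let $N,s$ be positive integers, let $\mathbf{M}_1,\dots,\mathbf{M}_N\in\mathbb{R}^{s\times s}$, and let $k$ be an integer with $1\le k\le N+1$. Let $\mathbf{L}$ and $\mathbf{L}_M=\mathbf{L}_M(k)$ be the $(N+1)s\times(N+1)s$ matrices defined in the context. If $\|\mathbf{M}_i\mathbf{M}_i^\top\|_2\le 1$ for all $i$, then every eigenvalue of $\mathbf{L}_M^{-\top}\mathbf{L}^\top\mathbf{L}\mathbf{L}_M^{-1}$ is bounded above by $k+1+2\sqrt{k}$.
   Context: $\mathbf{L}\in\mathbb{R}^{(N+1)s\times(N+1)s}$ is the block matrix with $s\times s$ blocks whose diagonal blocks are the identity $\mathbf{I}$, whose $(j+1,j)$th block is $-\mathbf{M}_j$ for $j=1,\dots,N$, and whose other blocks are zero. For $k\in\mathbb{N}$, $\mathbf{L}_M=\mathbf{L}_M(k)\in\mathbb{R}^{(N+1)s\times(N+1)s}$ is the block matrix with $s\times s$ blocks such that, for $i,j=1,\dots,N+1$, its $(i,j)$th block is $\mathbf{I}$ if $i=j$; $-\mathbf{M}_j$ if $i=j+1$ and $j$ is not divisible by $k$; and $\mathbf{0}$ otherwise. The parameter $k$ is user-chosen with $1\le k\le N+1$. $\mathbf{X}^{-\top}$ denotes $(\mathbf{X}^{-1})^\top$, and $\|\cdot\|_2$ is the spectral norm. *)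

(* Defs.v *)
From mathcomp Require Export all_boot all_order all_algebra.
From mathcomp Require Export boolp classical_sets reals.
Import Order.TTheory GRing.Theory Num.Theory.

Set Implicit Arguments.
Unset Strict Implicit.
Unset Printing Implicit Defensive.

Local Open Scope ring_scope.

Definition l2norm (R : realType) (n : nat) (x : 'cV[R]_n) : R :=
  Num.sqrt (\sum_(i < n) x i 0 ^+ 2).

Definition spectral_norm (R : realType) (m n : nat) (A : 'M[R]_(m, n)) : R :=
  sup [set l2norm (A *m x) | x in [set x : 'cV[R]_n | l2norm x <= 1]]%classic.

(* [sup] is 0 on sets without a supremum; this case does not occur in
   [spectral_norm]. *)
Lemma spectral_norm_has_sup (R : realType) (m n : nat) (A : 'M[R]_(m, n)) :
  has_sup [set l2norm (A *m x) | x in [set x : 'cV[R]_n | l2norm x <= 1]]%classic.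
Proof.
split.
  exists (l2norm (A *m 0)); exists 0 => //=.
  rewrite /l2norm big1 ?sqrtr0 ?ler01 // => i _.
  by rewrite mxE expr0n.
exists (Num.sqrt (\sum_i (\sum_j `|A i j|) ^+ 2)) => _ [x /= x1 <-].
have xj j : `|x j 0| <= 1.
  rewrite -sqrtr_sqr; apply: le_trans x1; rewrite /l2norm ler_wsqrtr //.
  rewrite (bigD1 j) //= lerDl; apply: sumr_ge0 => i _; exact: sqr_ge0.
rewrite /l2norm ler_wsqrtr //; apply: ler_sum => i _.
rewrite -[X in X <= _]real_normK ?num_real // lerXn2r ?nnegrE //.
  by apply: sumr_ge0.
rewrite mxE; apply: le_trans (ler_norm_sum _ _ _) _.
apply: ler_sum => j _; rewrite normrM ler_piMr //.
Qed.

(* Blocks and the matrices [M] are indexed from 0, so [M j] is the usual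
   M_(j+1). The size is (N + 1)s, in the form [\sum_(i < N.+1) s] expected
   by [mxblock]. For [j : 'I_N.+1], [unlift ord_max j] is [Some l] with
   [l : 'I_N] of the same value as [j] when [j < N], and [None] when [j = N]. *)
Definition block_bidiag (R : realType) (N s : nat) (keep : pred 'I_N)
    (M : 'I_N -> 'M[R]_s) : 'M[R]_(\sum_(i < N.+1) s) :=
  \mxblock_(i < N.+1, j < N.+1)
    (if i == j then 1%:M
     else if unlift ord_max j is Some l then
       if (i == l.+1 :> nat) && keep l then - M l else 0
     else 0 : 'M[R]_s).

Definition Lmx (R : realType) (N s : nat) (M : 'I_N -> 'M[R]_s) :
    'M[R]_(\sum_(i < N.+1) s) :=
  block_bidiag xpredT M.

Definition LMmx (R : realType) (N s k : nat) (M : 'I_N -> 'M[R]_s) :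
    'M[R]_(\sum_(i < N.+1) s) :=
  block_bidiag (fun l : 'I_N => ~~ (k %| l.+1)%N) M.

(* Main.v *)
Require Import Defs.
From mathcomp Require Import ring lra.
Import Order.TTheory GRing.Theory Num.Theory.

Set Implicit Arguments.
Unset Strict Implicit.
Unset Printing Implicit Defensive.

Local Open Scope ring_scope.

(** Write B for the product of L with the inverse of L_M, and |.| for the
    Euclidean norm.  An eigenvalue a of B^T B satisfies a |y|^2 = |B y|^2 for
    some nonzero y, so it is enough to show |B y| <= (1 + sqrt k) |y|, the
    square of 1 + sqrt k being k + 1 + 2 sqrt k.

    Put x = L_M^-1 y, and let x_i, y_i be the blocks.  Then
    B y = L x = y + (L - L_M) x, where the nonzero blocks of (L - L_M) x are
    the - M_l x_l with l divisible by k (blocks numbered from 1).  The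
    hypothesis makes each M_l a contraction ([contraction_of_mulmx_tr]), so it
    remains to bound the sum of these |x_l|^2 by k |y|^2.  The equation
    L_M x = y says that x_(i+1) = y_(i+1) + M_i x_i, except when k divides i,
    where the recursion restarts with x_(i+1) = y_(i+1).  Hence |x_l|, for l
    divisible by k, is at most the sum of the |y_i| over the k indices i
    ending at l, and Cauchy-Schwarz gives
    |x_l|^2 <= k (sum of these |y_i|^2); the windows are disjoint.

    Only squared norms are used.  The triangle and Cauchy-Schwarz inequalities
    are replaced by |x - y|^2 <= (1 + t) |x|^2 + (1 + 1/t) |y|^2 for t > 0
    ([sqnormB_le]); choosing t = r at the r-th step of a window reproduces
    Cauchy-Schwarz ([restarted_recursion_sum]), and t = sqrt k gives the final
    constant. *)

(** The squared Euclidean norm of a column vector. *)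
Definition sqnorm (R : realType) (n : nat) (x : 'cV[R]_n) : R :=
  \sum_(i < n) x i 0 ^+ 2.

(** * The squared norm *)

Section SquaredNorm.
Variable R : realType.

Lemma sqnormE n (x : 'cV[R]_n) : sqnorm x = (x^T *m x) 0 0.
Proof. by rewrite mxE; apply: eq_bigr => i _; rewrite mxE expr2. Qed.

Lemma sqnorm_ge0 n (x : 'cV[R]_n) : 0 <= sqnorm x.
Proof. by apply: sumr_ge0 => i _; apply: sqr_ge0. Qed.

Lemma sqnorm0 n : sqnorm (0 : 'cV[R]_n) = 0.
Proof. by rewrite /sqnorm big1 // => i _; rewrite mxE expr0n. Qed.

Lemma sqnorm_eq0 n (x : 'cV[R]_n) : (sqnorm x == 0) = (x == 0).
Proof.
apply/idP/eqP => [|->]; last by rewrite sqnorm0.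
rewrite psumr_eq0 => [/allP x0|i _]; last exact: sqr_ge0.
apply/colP => i; rewrite mxE; apply/eqP; rewrite -sqrf_eq0.
exact: x0 (mem_index_enum i).
Qed.

Lemma sqnormZ n c (x : 'cV[R]_n) : sqnorm (c *: x) = c ^+ 2 * sqnorm x.
Proof. by rewrite /sqnorm mulr_sumr; apply: eq_bigr => i _; rewrite mxE exprMn. Qed.

Lemma sqnormB_le n t (x y : 'cV[R]_n) : 0 < t ->
  sqnorm (x - y) <= (1 + t) * sqnorm x + (1 + t^-1) * sqnorm y.
Proof.
move=> t0; rewrite /sqnorm !mulr_sumr -big_split; apply: ler_sum => i _ /=.
rewrite !mxE; set u := x i 0; set v := y i 0; rewrite -subr_ge0.
have -> : (1 + t) * u ^+ 2 + (1 + t^-1) * v ^+ 2 - (u - v) ^+ 2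
          = (t * u + v) ^+ 2 / t by field; rewrite gt_eqF.
by rewrite divr_ge0 ?sqr_ge0 ?ltW.
Qed.

Lemma dotmx_le n (x y : 'cV[R]_n) :
  2 * (x^T *m y) 0 0 <= sqnorm x + sqnorm y.
Proof.
rewrite mxE mulr_sumr /sqnorm -big_split; apply: ler_sum => i _ /=.
rewrite mxE; have := sqr_ge0 (x i 0 - y i 0); nra.
Qed.

Lemma sqnorm_submxcol n (p_ : 'I_n -> nat) (x : 'cV[R]_(\sum_i p_ i)) :
  sqnorm x = \sum_i sqnorm (submxcol x i).
Proof.
rewrite sqnormE -(submxcolK x) tr_mxcol mul_mxrow_mxcol summxE.
by apply: eq_bigr => i _; rewrite mxcolK sqnormE.
Qed.

(** * Contractions *)

Lemma spectral_norm_sqnorm_le m n (A : 'M[R]_(m, n)) (x : 'cV[R]_n) :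
  spectral_norm A <= 1 -> sqnorm (A *m x) <= sqnorm x.
Proof.
move=> A1; have [->|x0] := eqVneq x 0; first by rewrite mulmx0 !sqnorm0.
have q0 : 0 < sqnorm x by rewrite lt_def sqnorm_eq0 x0 sqnorm_ge0.
set c := (Num.sqrt (sqnorm x))^-1.
have cE : c ^+ 2 = (sqnorm x)^-1 by rewrite exprVn sqr_sqrtr ?ltW.
have : l2norm (A *m (c *: x)) <= 1.
  apply: le_trans A1; apply: ub_le_sup; first exact: (spectral_norm_has_sup A).2.
  exists (c *: x) => //=; rewrite /l2norm -/(sqnorm _) sqnormZ cE mulVf ?gt_eqF //.
  by rewrite sqrtr1.
rewrite /l2norm -/(sqnorm _) -scalemxAr sqnormZ cE -sqrtr1 ler_sqrt ?ltr01 //.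
by rewrite mulrC ler_pdivrMr // mul1r.
Qed.

(** For every y, |A^T y|^2 = <y, A A^T y> is at most the mean of |y|^2 and
    |A A^T y|^2, hence at most |y|^2.  Then |A x|^2 = <x, A^T A x> is at most
    the mean of |x|^2 and |A^T A x|^2 <= |A x|^2. *)
Lemma contraction_of_mulmx_tr m n (A : 'M[R]_(m, n)) (x : 'cV[R]_n) :
  spectral_norm (A *m A^T) <= 1 -> sqnorm (A *m x) <= sqnorm x.
Proof.
move=> A1.
have AT (y : 'cV_m) : sqnorm (A^T *m y) <= sqnorm y.
  have := dotmx_le y (A *m A^T *m y).
  have := spectral_norm_sqnorm_le y A1.
  rewrite [sqnorm (A^T *m y)]sqnormE trmx_mul trmxK !mulmxA; lra.
have := dotmx_le x (A^T *m (A *m x)); have := AT (A *m x).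
rewrite mulmxA [sqnorm (A *m x)]sqnormE trmx_mul !mulmxA; lra.
Qed.

End SquaredNorm.

(** * Block bidiagonal matrices *)

Section BlockBidiagonal.
Variables (R : realType) (N s : nat) (keep : pred 'I_N) (M : 'I_N -> 'M[R]_s).

Lemma unitmx_block_bidiag : block_bidiag keep M \in unitmx.
Proof.
have trig : is_trig_mx (block_bidiag keep M).
  apply/is_trig_mxblockP; split=> [i j ij|i]; last by rewrite eqxx scalar_mx_is_trig.
  rewrite -val_eqE ltn_eqF //; case: unliftP => // l jE.
  by case: eqP => //= iE; move: ij; rewrite jE iE lift_max ltnNge leqnSn.
rewrite unitmxE det_trig // big1 ?unitr1 // => i _.
by rewrite mxE eqxx mxE eqxx.
Qed.

Lemma submxcol_block_bidiag0 (x : 'cV[R]_(\sum_(i < N.+1) s)) :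
  submxcol (block_bidiag keep M *m x) ord0 = submxcol x ord0.
Proof.
rewrite -{1}(submxcolK x) mul_mxblock_mxrow mxcolK (bigD1 ord0) //= mul1mx.
rewrite big1 ?addr0 // => j; rewrite eq_sym => /negPf ->.
by case: unlift => [l|]; rewrite mul0mx.
Qed.

Lemma submxcol_block_bidiagS (x : 'cV[R]_(\sum_(i < N.+1) s)) (l : 'I_N) :
  submxcol (block_bidiag keep M *m x) (lift ord0 l) =
  submxcol x (lift ord0 l)
    - (if keep l then M l *m submxcol x (lift ord_max l) else 0).
Proof.
have neq : lift ord_max l != lift ord0 l.
  by apply/eqP => /(congr1 (@nat_of_ord _)) /eqP; rewrite lift_max lift0 ltn_eqF.
rewrite -{1}(submxcolK x) mul_mxblock_mxrow mxcolK (bigD1 (lift ord0 l)) //=.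
rewrite eqxx mul1mx; congr (_ + _); rewrite (bigD1 (lift ord_max l)) //=.
rewrite eq_sym (negPf neq) liftK eqxx /= big1 => [|j /andP[j1 j2]].
  by case: keep; rewrite ?addr0 ?mulNmx ?mul0mx ?oppr0.
rewrite eq_sym (negPf j1); case: unliftP => [l' jE|_]; last by rewrite mul0mx.
case: eqP => [[ll']|_]; last by rewrite mul0mx.
by rewrite jE (ord_inj ll') eqxx in j2.
Qed.

End BlockBidiagonal.

(** * The restarted recursion *)

(** Here X i and Y i stand for |x_i|^2 and |y_i|^2, with i counted from 0, so
    that the recursion restarts at the multiples of k.  The sums are compared
    by induction on n; inside a window, with r = n mod k > 0, the term
    (k / r) X_(n-1) on the left records the part of the right-hand side not
    yet spent on the window. *)
Lemma restarted_recursion_sum (R : realType) (N k : nat) (X Y : nat -> R) :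
  (0 < k)%N -> (forall i, 0 <= X i) ->
  (forall i, (i <= N)%N -> (k %| i)%N -> X i <= Y i) ->
  (forall i t, (i < N)%N -> ~~ (k %| i.+1)%N -> 0 < t ->
     X i.+1 <= (1 + t) * Y i.+1 + (1 + t^-1) * X i) ->
  forall n, (n <= N.+1)%N ->
  \sum_(i < n | (k %| i.+1)%N) X i
    + (if (k %| n)%N then 0 else k%:R / (n %% k)%:R * X n.-1)
  <= k%:R * \sum_(i < n) Y i.
Proof.
move=> k0 X0 Xrestart Xstep; elim=> [|n IHn] ltnN.
  by rewrite dvdn0 !big_ord0 addr0 mulr0.
have kR0 : 0 < k%:R :> R by rewrite ltr0n.
rewrite big_mkcond big_ord_recr /= -big_mkcond big_ord_recr /= mulrDr.
(* The last two terms on the left equal (k / r') X_n with r' = (n mod k) + 1,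
   whether or not the window ends at n. *)
set r' : R := (n %% k).+1%:R.
have -> : (\sum_(i < n | (k %| i.+1)%N) X i
             + (if (k %| n.+1)%N then X n else 0))
          + (if (k %| n.+1)%N then 0 else k%:R / (n.+1 %% k)%:R * X n)
        = \sum_(i < n | (k %| i.+1)%N) X i + k%:R / r' * X n.
  have := modnS n k; case: ifP => [kn _|_ ->]; last by rewrite addr0 -/r'.
  have -> : r' = k%:R; last by rewrite addr0 divff ?gt_eqF // mul1r.
  congr _%:R; apply/eqP; rewrite eqn_leq ltn_pmod //= dvdn_leq //.
  by rewrite /dvdn -addn1 modnDml addn1.
apply: le_trans (lerD (IHn (ltnW ltnN)) (lexx _)).
rewrite -addrA lerD2l; case: ifPn => kn.
  have -> : r' = 1 by rewrite /r' (eqP kn).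
  by rewrite divr1 add0r ler_pM2l // Xrestart.
case: n kn ltnN @r' {IHn} => [|n] kn ltnN r'; first by rewrite dvdn0 in kn.
rewrite /= -!mulrA -mulrDr ler_pM2l //.
set r : R := (n.+1 %% k)%:R in r' *.
have r0 : 0 < r by rewrite ltr0n lt0n.
have r'E : r' = 1 + r by rewrite /r' /r -natr1 addrC.
rewrite mulrC ler_pdivrMr ?r'E; last by rewrite addr_gt0.
apply: le_trans (Xstep n r _ kn r0) _ => //.
by rewrite le_eqVlt; apply/orP; left; apply/eqP; field; rewrite gt_eqF.
Qed.

(** * The bound *)

(** |L x|^2 <= (1 + sqrt k)^2 |L_M x|^2. *)
Lemma sqnorm_Lmx_le (R : realType) (N s k : nat) (M : 'I_N -> 'M[R]_s)
    (x : 'cV[R]_(\sum_(i < N.+1) s)) :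
  (0 < k)%N ->
  (forall (i : 'I_N) (u : 'cV[R]_s), sqnorm (M i *m u) <= sqnorm u) ->
  sqnorm (Lmx M *m x)
    <= (k%:R + 1 + 2 * Num.sqrt k%:R) * sqnorm (LMmx k M *m x).
Proof.
move=> k0 Mle; set y := LMmx k M *m x.
pose e := y - Lmx M *m x.
have e0 : submxcol e ord0 = 0.
  by rewrite submxcolB !submxcol_block_bidiag0 subrr.
have eS (l : 'I_N) : submxcol e (lift ord0 l) =
    if (k %| l.+1)%N then M l *m submxcol x (lift ord_max l) else 0.
  rewrite submxcolB !submxcol_block_bidiagS /=.
  by case: (k %| _)%N; rewrite /= ?subr0 ?subrr // opprB addrC subrK.
pose X i := sqnorm (submxcol x (inord i : 'I_N.+1)).
pose Y i := sqnorm (submxcol y (inord i : 'I_N.+1)).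
have inordS (l : 'I_N) : inord l.+1 = lift ord0 l :> 'I_N.+1.
  by apply: ord_inj; rewrite lift0 inordK // ltnS.
have inordW (l : 'I_N) : inord l = lift ord_max l :> 'I_N.+1.
  by apply: ord_inj; rewrite lift_max inordK // ltnW // ltnS.
have eY : sqnorm e <= k%:R * sqnorm y.
  have -> : sqnorm y = \sum_(i < N.+1) Y i.
    by rewrite sqnorm_submxcol; apply: eq_bigr => i _; rewrite /Y inord_val.
  have Xrestart i : (i <= N)%N -> (k %| i)%N -> X i <= Y i.
    case: i => [_ _|i ltiN ki].
      rewrite /X /Y; have -> : inord 0 = ord0 :> 'I_N.+1.
        by apply: val_inj; rewrite /= inordK.
      by rewrite submxcol_block_bidiag0.
    rewrite /X /Y (inordS (Ordinal ltiN)) submxcol_block_bidiagS /= ki /=.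
    by rewrite subr0.
  have Xstep i t : (i < N)%N -> ~~ (k %| i.+1)%N -> 0 < t ->
      X i.+1 <= (1 + t) * Y i.+1 + (1 + t^-1) * X i.
    move=> ltiN ki t0; pose l := Ordinal ltiN.
    rewrite /X /Y (inordS l) (inordW l).
    set xl := submxcol x (lift ord_max l).
    have -> : submxcol x (lift ord0 l) =
              submxcol y (lift ord0 l) - (- M l) *m xl.
      by rewrite submxcol_block_bidiagS /= ki mulNmx opprK subrK.
    apply: le_trans (sqnormB_le _ _ t0) _; rewrite lerD2l ler_pM2l.
      by rewrite mulNmx -scaleN1r sqnormZ sqrrN expr1n mul1r.
    by rewrite addr_gt0 ?ltr01 ?invr_gt0.
  have /= := restarted_recursion_sum k0 (fun i => sqnorm_ge0 _)
    Xrestart Xstep (leqnn N.+1).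
  apply: le_trans; rewrite sqnorm_submxcol big_ord_recl e0 sqnorm0 add0r.
  rewrite [X in _ <= X + _]big_mkcond big_ord_recr /= -addrA -[leLHS]addr0 lerD //.
    apply: ler_sum => l _; rewrite eS; case: (k %| _)%N.
      by rewrite /X inordW Mle.
    by rewrite sqnorm0.
  rewrite addr_ge0 //; case: (k %| _)%N => //; try exact: sqnorm_ge0.
  by rewrite mulr_ge0 ?divr_ge0 ?ler0n ?sqnorm_ge0.
have -> : Lmx M *m x = y - e by rewrite /e opprB addrC subrK.
set t := Num.sqrt (k%:R : R).
have t0 : 0 < t by rewrite sqrtr_gt0 ltr0n.
have tt : t ^+ 2 = k%:R by rewrite sqr_sqrtr ?ler0n.
apply: le_trans (sqnormB_le y e t0) _.
have c0 : 0 < 1 + t^-1 by rewrite addr_gt0 ?ltr01 ?invr_gt0.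
apply: le_trans (lerD (lexx _) (_ : _ <= (1 + t^-1) * (k%:R * sqnorm y))) _.
  by rewrite ler_pM2l.
by rewrite -tt le_eqVlt; apply/orP; left; apply/eqP; field; rewrite gt_eqF.
Qed.

Theorem proposition2 (R : realType) (N s k : nat) (M : 'I_N -> 'M[R]_s)
    (N_gt0 : (0 < N)%N) (s_gt0 : (0 < s)%N)
    (k_gt0 : (1 <= k)%N) (k_le : (k <= N.+1)%N)
    (M_le1 : forall i : 'I_N, spectral_norm (M i *m (M i)^T) <= 1)
    (a : R) :
  eigenvalue ((invmx (LMmx k M))^T *m (Lmx M)^T *m Lmx M *m invmx (LMmx k M)) a ->
  a <= k%:R + 1 + 2 * Num.sqrt k%:R.
Proof.
move=> /eigenvalueP[v vE v0]; set K := invmx _ in vE.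
set y := v^T; have y0 : 0 < sqnorm y.
  by rewrite lt_def sqnorm_ge0 sqnorm_eq0 trmx_eq0 v0.
have : sqnorm (Lmx M *m (K *m y)) = a * sqnorm y.
  rewrite !sqnormE !trmx_mul trmxK !mulmxA; rewrite !mulmxA in vE.
  by rewrite vE -scalemxAl mxE.
have := sqnorm_Lmx_le (K *m y) k_gt0
  (fun i u => contraction_of_mulmx_tr u (M_le1 i)).
rewrite [LMmx k M *m _]mulKVmx ?unitmx_block_bidiag // => yle yE.
by rewrite yE ler_pM2r in yle.
Qed.
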